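(* For every real number $m>\frac{1}{2}$, $$ \frac{1}{3m^2+3m^3}\cdot{}_4F_3\left(1,1,1,\tfrac{3}{2};\tfrac{4}{3},\tfrac{5}{3},2;\frac{4}{27(m^2+m^3)}\right)=\sum_{n\geq 1}\frac{1}{n^2 (m^2+m^3)^n \binom{3n}{n}}=\frac{2}{3}\arctan^2\sqrt{\frac{3m-1}{(m+1)(2m-1)^2}}-\frac{1}{2}\log^2\left(1+\frac{1}{m}\right), $$ where $\arctan^2 x=(\arctan x)^2$, $\log^2(x)=(\log x)^2$ and $\log$ is the natural logarithm.
   Context: The hypergeometric function is defined by the series ${}_4F_3(a,b,c,d;e,f,g;z)=\sum_{n\geq 0}\frac{(a)_n(b)_n(c)_n(d)_n}{n!\,(e)_n(f)_n(g)_n}\,z^n$, where $(a)_n=\frac{\Gamma(a+n)}{\Gamma(a)}$ is the rising factorial (Pochhammer symbol). *)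

(* Defs.v *)
From Stdlib Require Import Reals Factorial.
From Coquelicot Require Import Coquelicot.
Open Scope R_scope.

(** Euler's integral; it represents Gamma only for [0 < x].  Since
    [Rpower 0 _] is not the power function at 0, the lower end is approached
    from the right. *)
Definition Gamma (x : R) : R :=
  RInt_gen (fun t => Rpower t (x - 1) * exp (- t))
    (at_right 0) (Rbar_locally p_infty).

Definition pochhammer (a : R) (n : nat) : R := Gamma (a + INR n) / Gamma a.

Definition hyp4F3_coef (a b c d e f g : R) (n : nat) : R :=
  (pochhammer a n * pochhammer b n * pochhammer c n * pochhammer d n) /
  (INR (fact n) * (pochhammer e n * pochhammer f n * pochhammer g n)).

Definition hyp4F3 (a b c d e f g z : R) : R :=
  PSeries (hyp4F3_coef a b c d e f g) z.

(** [Binomial.C] is the binomial coefficient; a bare [C] would be Coquelicot's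
    type of complex numbers. *)
Definition inv_binom_term (m : R) (n : nat) : R :=
  1 / (INR n ^ 2 * (m ^ 2 + m ^ 3) ^ n * Binomial.C (3 * n) n).

(* Main.v *)
(** Write [z = 1 / (m^2 + m^3)] and view the binomial sum [S(z)] as a function of
    [m].  The beta integral [1 / ((n + 1) C(3n+3, n+1)) = int_0^1 x^(2n+2) (1-x)^n dx]
    and a geometric summation give [S'(z) = int_0^1 x^2 / (1 - z x^2 (1 - x)) dx].
    The parametrisation of [z] by [m] is what makes this integral elementary:
    [m^2 + m^3 - x^2 (1 - x) = (x + m) (x^2 - (m + 1) x + m (m + 1))].  Hence both
    sides have the same derivative in [m], and both tend to 0 as [m] tends to
    infinity.  The hypergeometric series has the same term ratios as [S]; for the
    Pochhammer symbols this rests on [Gamma (x + 1) = x Gamma x], proved for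
    [1 <= x], where Euler's integrand is bounded by a multiple of [exp (- t / 2)]. *)

Require Import Defs.
From Stdlib Require Import Reals Factorial.
From Coquelicot Require Import Coquelicot.
From Stdlib Require Import Lra Lia.
Open Scope R_scope.

(** * The Gamma integral and Pochhammer symbols *)

(** Since [f] is nonnegative, its integrals grow with the interval, so their supremum is the
    improper integral. The second conjunct later yields positivity of [Gamma]. *)
Lemma is_RInt_gen_0_infty_nonneg (f : R -> R) (M : R) :
  (forall t, 0 < t -> continuous f t) ->
  (forall t, 0 < t -> 0 <= f t) ->
  (forall a b, 0 < a -> a <= b -> RInt f a b <= M) ->
  exists l, is_RInt_gen f (at_right 0) (Rbar_locally p_infty) l /\
    forall a b, 0 < a -> a <= b -> RInt f a b <= l.
Proof.
  intros Hc Hp HM.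
  assert (Hex : forall a b, 0 < a -> 0 < b -> ex_RInt f a b).
  { intros a b Ha Hb. apply (ex_RInt_continuous (V := R_CompleteNormedModule)).
    intros z [Hz _].
    apply Hc. apply Rlt_le_trans with (2 := Hz). now apply Rmin_glb_lt. }
  assert (Hge : forall a b, 0 < a -> a <= b -> 0 <= RInt f a b).
  { intros a b Ha Hab. apply RInt_ge_0; [easy | apply Hex; lra |].
    intros x Hx; apply Hp; lra. }
  destruct (completeness
    (fun r => exists a b, 0 < a /\ a <= b /\ r = RInt f a b)) as [l [Hub Hlub]].
  - exists M. intros r (a & b & Ha & Hab & ->). now apply HM.
  - exists (RInt f 1 1), 1, 1. repeat split; lra.
  - assert (Hl : forall a b, 0 < a -> a <= b -> RInt f a b <= l).
    { intros a b Ha Hab. apply Hub. now exists a, b. }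
    exists l. split; [| exact Hl].
    intros P [eps HP].
    assert (Ha0 : exists a0 b0, 0 < a0 /\ a0 <= b0 /\ l - eps < RInt f a0 b0).
    { apply Classical_Prop.NNPP. intros Hn.
      assert (l <= l - eps); [| destruct eps; simpl in *; lra].
      apply Hlub. intros r (a & b & Ha & Hab & ->).
      apply Rnot_lt_le. intros Hlt. apply Hn. now exists a, b. }
    destruct Ha0 as (a0 & b0 & Ha0 & Hab0 & Hlt).
    apply (Filter_prod _ _ _ (fun a => 0 < a < a0) (fun b => b0 < b)).
    + exists (mkposreal a0 Ha0). intros y Hy Hy0.
      apply Rabs_lt_between in Hy. cbn in Hy. unfold minus, plus, opp in Hy.
      cbn in Hy. lra.
    + now exists b0.
    + intros a b Ha Hb. cbn. exists (RInt f a b). split.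
      * apply (RInt_correct f). apply Hex; lra.
      * apply HP. apply Rabs_lt_between'.
        (* The outer pieces are nonnegative, so enlarging [[a0, b0]] keeps the integral above
           [l - eps]. *)
        assert (E : RInt f a b = RInt f a a0 + (RInt f a0 b0 + RInt f b0 b)).
        { rewrite <- (RInt_Chasles f a a0 b), <- (RInt_Chasles f a0 b0 b);
            try (apply Hex; lra).
          reflexivity. }
        assert (H1 := Hge a a0 ltac:(lra) ltac:(lra)).
        assert (H2 := Hge b0 b ltac:(lra) ltac:(lra)).
        assert (H3 := Hl a b ltac:(lra) ltac:(lra)).
        destruct eps; simpl in *; lra.
Qed.

Lemma exp_le (x y : R) : x <= y -> exp x <= exp y.
Proof.
  intros [H | ->]; [left; now apply exp_increasing | apply Rle_refl].
Qed.

(** Apply [1 + ln u <= u] at [u = t / (2 (y + 1))] and multiply by [y]. The divisor [2 (y + 1)]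
    stays positive even for [y = 0]. *)
Lemma Rpower_le_exp_half (y t : R) :
  0 <= y -> 0 < t -> Rpower t y <= exp (y * ln (2 * (y + 1))) * exp (t / 2).
Proof.
  intros Hy Ht. unfold Rpower. rewrite <- exp_plus.
  apply exp_le.
  assert (H : ln t <= t / (2 * (y + 1)) + ln (2 * (y + 1))).
  { replace (ln t) with (ln (t / (2 * (y + 1))) + ln (2 * (y + 1))).
    - assert (H0 : 0 < t / (2 * (y + 1))) by (apply Rdiv_lt_0_compat; lra).
      assert (H := exp_ineq1_le (ln (t / (2 * (y + 1))))).
      rewrite exp_ln in H by easy. lra.
    - rewrite <- ln_mult; [f_equal; field; lra | | lra].
      apply Rdiv_lt_0_compat; lra. }
  apply Rle_trans with (y * (t / (2 * (y + 1)) + ln (2 * (y + 1)))).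
  - now apply Rmult_le_compat_l.
  - assert (y * (t / (2 * (y + 1))) <= t / 2); [| lra].
    apply Rmult_le_reg_r with (2 * (y + 1)); [lra |].
    replace (y * (t / (2 * (y + 1))) * (2 * (y + 1))) with (y * t) by (field; lra).
    nra.
Qed.

Lemma Gamma_integrand_bound (y t : R) :
  0 <= y -> 0 < t ->
  Rpower t y * exp (- t) <= exp (y * ln (2 * (y + 1))) * exp (- t / 2).
Proof.
  intros Hy Ht.
  replace (exp (- t / 2)) with (exp (t / 2) * exp (- t))
    by (rewrite <- exp_plus; f_equal; field).
  rewrite <- Rmult_assoc. apply Rmult_le_compat_r.
  - left; apply exp_pos.
  - now apply Rpower_le_exp_half.
Qed.

Lemma continuous_Gamma_integrand (y t : R) :
  0 < t -> continuous (fun t => Rpower t y * exp (- t)) t.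
Proof.
  intros Ht. apply (ex_derive_continuous (fun t => Rpower t y * exp (- t))).
  unfold Rpower. auto_derive. easy.
Qed.

Lemma Gamma_spec (x : R) :
  1 <= x ->
  is_RInt_gen (fun t => Rpower t (x - 1) * exp (- t))
    (at_right 0) (Rbar_locally p_infty) (Gamma x) /\ 0 < Gamma x.
Proof.
  intros Hx. set (f := fun t => Rpower t (x - 1) * exp (- t)).
  assert (Hf : forall t, 0 < f t).
  { intros t. apply Rmult_lt_0_compat; apply exp_pos. }
  assert (Hex : forall a b, 0 < a -> a <= b -> ex_RInt f a b).
  { intros a b Ha Hab. apply (ex_RInt_continuous (V := R_CompleteNormedModule)).
    intros t.
    rewrite Rmin_left by lra. intros Ht. apply continuous_Gamma_integrand; lra. }
  set (K := exp ((x - 1) * ln (2 * (x - 1 + 1)))).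
  assert (HK : 0 < K) by apply exp_pos.
  destruct (is_RInt_gen_0_infty_nonneg f (2 * K)) as (l & Hl & Hle).
  - intros t. apply continuous_Gamma_integrand.
  - intros t _. now left.
  - intros a b Ha Hab.
    (* The majorant has integral at most [2 K], uniformly in [a] and [b]. *)
    assert (HI : is_RInt (fun t => K * exp (- t / 2)) a b
       (minus (- 2 * K * exp (- b / 2)) (- 2 * K * exp (- a / 2)))).
    { apply (is_RInt_derive (fun t => - 2 * K * exp (- t / 2))).
      - intros t _. auto_derive; [easy |]. unfold Rdiv. field.
      - intros t _. apply (ex_derive_continuous (fun t => K * exp (- t / 2))).
        auto_derive. easy. }
    apply Rle_trans with (1 := is_RInt_le _ _ _ _ _ _ Hab
      (RInt_correct f a b (Hex a b Ha Hab)) HI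
      (fun t Ht => Gamma_integrand_bound (x - 1) t ltac:(lra) ltac:(lra))).
    unfold minus, plus, opp. cbn.
    assert (0 < exp (- b / 2)) by apply exp_pos.
    assert (exp (- a / 2) <= 1).
    { rewrite <- exp_0. apply exp_le. lra. }
    nra.
  - assert (E : Gamma x = l) by (unfold Gamma; now apply is_RInt_gen_unique).
    rewrite E. split; [exact Hl |].
    apply Rlt_le_trans with (2 := Hle 1 2 ltac:(lra) ltac:(lra)).
    apply RInt_gt_0; [lra | intros; apply Hf |].
    intros t Ht. apply continuous_Gamma_integrand; lra.
Qed.

(** Integration by parts: [F] vanishes at both ends, so its derivative [f] integrates to 0, while
    linearity evaluates the same integral as [x * Gamma x - Gamma (x + 1)]. *)
Lemma Gamma_add_1 (x : R) : 1 <= x -> Gamma (x + 1) = x * Gamma x.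
Proof.
  intros Hx.
  set (F := fun t => Rpower t x * exp (- t)).
  set (f := fun t => x * (Rpower t (x - 1) * exp (- t)) - F t).
  assert (HF : forall t, 0 < t -> is_derive F t (f t)).
  { intros t Ht. unfold f, F, Rpower. auto_derive; [easy |].
    replace (exp ((x - 1) * ln t)) with (exp (x * ln t) * / t); [field; lra |].
    replace ((x - 1) * ln t) with (x * ln t + - ln t) by ring.
    rewrite exp_plus, exp_Ropp, exp_ln; easy. }
  destruct (Gamma_spec x Hx) as [HG _].
  destruct (Gamma_spec (x + 1) ltac:(lra)) as [HG1 _].
  replace (x + 1 - 1) with x in HG1 by ring.
  assert (Hcont : forall t, 0 < t -> continuous f t).
  { intros t Ht.
    apply (continuous_minus (fun t => x * (Rpower t (x - 1) * exp (- t))) F).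
    - apply (continuous_scal_r x (fun t => Rpower t (x - 1) * exp (- t))).
      now apply continuous_Gamma_integrand.
    - now apply continuous_Gamma_integrand. }
  assert (Hpos : filter_prod (at_right 0) (Rbar_locally p_infty)
    (fun ab => forall t, Rmin (fst ab) (snd ab) <= t <= Rmax (fst ab) (snd ab) ->
       0 < t)).
  { apply (Filter_prod _ _ _ (fun a => 0 < a) (fun b => 0 < b)).
    - exists (mkposreal 1 Rlt_0_1). easy.
    - now exists 0.
    - intros a b Ha Hb t [Ht _]. cbn in Ht.
      apply Rlt_le_trans with (2 := Ht). now apply Rmin_glb_lt. }
  assert (HD : is_RInt_gen (Derive F) (at_right 0) (Rbar_locally p_infty) (0 - 0)).
  { apply is_RInt_gen_Derive.
    - apply filter_imp with (2 := Hpos). intros ab H t Ht.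
      exists (f t). apply HF, (H t Ht).
    - apply filter_imp with (2 := Hpos). intros ab H t Ht.
      specialize (H t Ht).
      apply continuous_ext_loc with f; [| now apply Hcont].
      exists (mkposreal t H). intros y Hy. symmetry. apply is_derive_unique, HF.
      apply Rabs_lt_between in Hy. cbn in Hy. unfold minus, plus, opp in Hy.
      cbn in Hy. lra.
    - apply filterlim_locally. intros eps.
      assert (He : 0 < Rmin eps 1) by (apply Rmin_glb_lt; [apply cond_pos | lra]).
      exists (mkposreal _ He). intros t Ht Ht0.
      apply Rabs_lt_between in Ht. cbn in Ht. unfold minus, plus, opp in Ht.
      cbn in Ht.
      assert (t < eps) by (eapply Rlt_le_trans; [| apply (Rmin_l eps 1)]; lra).
      assert (t < 1) by (eapply Rlt_le_trans; [| apply (Rmin_r eps 1)]; lra).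
      assert (0 < F t) by (apply Rmult_lt_0_compat; apply exp_pos).
      (* For [t < 1] the logarithm is negative and [x >= 1], so [x * ln t - t <= ln t]. *)
      assert (F t <= t).
      { unfold F, Rpower. rewrite <- exp_plus. rewrite <- (exp_ln t) at 3 by easy.
        apply exp_le.
        assert (ln t < 0) by (rewrite <- ln_1; apply ln_increasing; lra).
        nra. }
      apply Rabs_lt_between. unfold minus, plus, opp. cbn. lra.
    - apply (is_lim_le_le_loc (fun _ => 0)
        (fun t => exp (x * ln (2 * (x + 1))) * exp (- t / 2))
        F p_infty 0).
      + exists 0. intros t Ht. split.
        * left. apply Rmult_lt_0_compat; apply exp_pos.
        * apply Gamma_integrand_bound; lra.
      + apply is_lim_const.
      + replace (Finite 0) with (Rbar_mult (exp (x * ln (2 * (x + 1)))) 0)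
          by (cbn; f_equal; ring).
        apply is_lim_scal_l.
        apply is_lim_ext with (fun t => exp (- / 2 * t + 0)).
        { intros t. f_equal. field. }
        apply is_lim_comp_lin; [| lra].
        replace (Rbar_plus _ _) with m_infty; [apply is_lim_exp_m |].
        simpl. destruct (Rle_dec 0 (- / 2)) as [H |];
          [exfalso; clear - H; lra | reflexivity]. }
  assert (HD' : is_RInt_gen (Derive F) (at_right 0) (Rbar_locally p_infty)
     (x * Gamma x - Gamma (x + 1))).
  { apply is_RInt_gen_ext with f.
    - apply filter_imp with (2 := Hpos). intros ab H t Ht. symmetry.
      apply is_derive_unique, HF, H. lra.
    - apply (is_RInt_gen_minus (fun t => x * (Rpower t (x - 1) * exp (- t))) F);
        [| easy].
      now apply (is_RInt_gen_scal (fun t => Rpower t (x - 1) * exp (- t)) x). }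
  assert (E := is_RInt_gen_unique _ _ HD).
  rewrite (is_RInt_gen_unique _ _ HD') in E. lra.
Qed.

Lemma pochhammer_0 (a : R) : 1 <= a -> pochhammer a 0 = 1.
Proof.
  intros Ha. unfold pochhammer. cbn. rewrite Rplus_0_r. apply Rdiv_diag.
  now apply Rgt_not_eq, Gamma_spec.
Qed.

(** The condition [1 <= a] comes from [Gamma_add_1]; the parameters 1, 3/2, 4/3, 5/3 and 2 all
    satisfy it. *)
Lemma pochhammer_S (a : R) (n : nat) :
  1 <= a -> pochhammer a (S n) = (a + INR n) * pochhammer a n.
Proof.
  intros Ha. unfold pochhammer. rewrite S_INR.
  replace (a + (INR n + 1)) with (a + INR n + 1) by ring.
  rewrite Gamma_add_1.
  - unfold Rdiv. ring.
  - assert (H := pos_INR n). lra.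
Qed.

Lemma pochhammer_pos (a : R) (n : nat) : 1 <= a -> 0 < pochhammer a n.
Proof.
  intros Ha. assert (H := pos_INR n).
  apply Rdiv_lt_0_compat; apply Gamma_spec; lra.
Qed.

(** * The series and its integral representation *)

(** The index is shifted by one: the coefficient of [z ^ n] belongs to the summand of index [n + 1],
    so the binomial sum is [z * PSeries inv_binom_coef z]. *)
Definition inv_binom_coef (n : nat) : R :=
  1 / (INR (S n) ^ 2 * Binomial.C (3 * S n) (S n)).

Lemma C_3n_n (n : nat) :
  Binomial.C (3 * n) n = INR (fact (3 * n)) / (INR (fact n) * INR (fact (2 * n))).
Proof.
  unfold Binomial.C. now replace (3 * n - n)%nat with (2 * n)%nat by lia.
Qed.

Lemma INR_fact_S (n : nat) : INR (fact (S n)) = (INR n + 1) * INR (fact n).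
Proof. now rewrite fact_simpl, mult_INR, S_INR. Qed.

Lemma inv_binom_coef_0 : inv_binom_coef 0 = 1 / 3.
Proof. unfold inv_binom_coef. rewrite C_3n_n. simpl. field. Qed.

(** Up to the factor 4/27 this is the term ratio of the hypergeometric series, after one [n + 1] has
    cancelled against the factorial. *)
Lemma inv_binom_coef_S (n : nat) :
  inv_binom_coef (S n) =
  4 / 27 * ((INR n + 1) ^ 2 * (INR n + 3 / 2) /
    ((INR n + 4 / 3) * (INR n + 5 / 3) * (INR n + 2))) * inv_binom_coef n.
Proof.
  unfold inv_binom_coef. rewrite !C_3n_n.
  replace (3 * S (S n))%nat with (S (S (S (3 * S n))))%nat by lia.
  replace (2 * S (S n))%nat with (S (S (2 * S n)))%nat by lia.
  rewrite !INR_fact_S, !S_INR, !mult_INR, !S_INR. simpl (INR 0).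
  assert (Hn := pos_INR n).
  assert (H1 := INR_fact_neq_0 n).
  assert (H2 := INR_fact_neq_0 (2 * S n)).
  assert (H3 := INR_fact_neq_0 (3 * S n)).
  field. repeat split; try easy; try lra.
Qed.

Lemma inv_binom_coef_pos (n : nat) : 0 < inv_binom_coef n.
Proof.
  unfold inv_binom_coef. rewrite C_3n_n.
  apply Rdiv_lt_0_compat; [lra |].
  apply Rmult_lt_0_compat; [apply pow_lt, lt_0_INR; lia |].
  apply Rdiv_lt_0_compat; [| apply Rmult_lt_0_compat]; apply INR_fact_lt_0.
Qed.

(** The rational factor in the recurrence is at most 1, so each step shrinks the coefficient by at
    least 4/27. *)
Lemma inv_binom_coef_bound (n : nat) : inv_binom_coef n <= 1 / 3 * (4 / 27) ^ n.
Proof.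
  induction n as [| n IH].
  - rewrite inv_binom_coef_0. simpl. lra.
  - rewrite inv_binom_coef_S. assert (Hn := pos_INR n).
    assert (Hc := inv_binom_coef_pos n).
    set (q := (_ + 1) ^ 2 * _ / _).
    assert (q <= 1).
    { unfold q. apply Rle_div_l; [repeat apply Rmult_lt_0_compat; lra | nra]. }
    simpl. nra.
Qed.

Lemma CV_radius_inv_binom_coef (z : R) :
  Rabs z < 27 / 4 -> Rbar_lt (Rabs z) (CV_radius inv_binom_coef).
Proof.
  intros Hz. apply Rbar_lt_le_trans with (27 / 4); [easy |].
  apply CV_radius_bounded. exists (1 / 3). intros n.
  assert (H := inv_binom_coef_bound n). assert (H0 := inv_binom_coef_pos n).
  assert (Hp : 0 < (27 / 4) ^ n) by (apply pow_lt; lra).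
  rewrite Rabs_pos_eq by nra.
  apply Rle_trans with (1 / 3 * (4 / 27) ^ n * (27 / 4) ^ n).
  - apply Rmult_le_compat_r; lra.
  - rewrite Rmult_assoc, <- Rpow_mult_distr.
    replace (4 / 27 * (27 / 4)) with 1 by field. rewrite pow1. lra.
Qed.

(** Both sides obey the same recurrence; the factor 3 matches the initial values 1 and 1/3. *)
Lemma hyp4F3_coef_inv_binom (n : nat) :
  hyp4F3_coef 1 1 1 (3 / 2) (4 / 3) (5 / 3) 2 n * (4 / 27) ^ n
  = 3 * inv_binom_coef n.
Proof.
  unfold hyp4F3_coef.
  induction n as [| n IH].
  - rewrite !pochhammer_0, inv_binom_coef_0 by lra. simpl. field.
  - rewrite inv_binom_coef_S, !pochhammer_S, INR_fact_S by lra.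
    assert (Hn := pos_INR n).
    assert (Hf := INR_fact_neq_0 n).
    assert (H4 := Rgt_not_eq _ _ (pochhammer_pos (4 / 3) n ltac:(lra))).
    assert (H5 := Rgt_not_eq _ _ (pochhammer_pos (5 / 3) n ltac:(lra))).
    assert (H2 := Rgt_not_eq _ _ (pochhammer_pos 2 n ltac:(lra))).
    rewrite (Rmult_comm _ (inv_binom_coef n)), <- (Rmult_assoc 3), <- IH.
    simpl. field. repeat split; try easy; lra.
Qed.

Lemma pseries_hyp4F3_coef (z : R) :
  Rabs z < 27 / 4 ->
  is_pseries (hyp4F3_coef 1 1 1 (3 / 2) (4 / 3) (5 / 3) 2) (4 / 27 * z)
    (3 * PSeries inv_binom_coef z).
Proof.
  intros Hz. apply is_pseries_R.
  apply is_series_ext with (fun n => scal 3 (inv_binom_coef n * z ^ n)).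
  - intros n. rewrite Rpow_mult_distr.
    change (3 * (inv_binom_coef n * z ^ n)
      = hyp4F3_coef 1 1 1 (3 / 2) (4 / 3) (5 / 3) 2 n * ((4 / 27) ^ n * z ^ n)).
    rewrite <- !Rmult_assoc, hyp4F3_coef_inv_binom. ring.
  - apply (is_series_scal 3 (fun n => inv_binom_coef n * z ^ n)), is_pseries_R.
    apply PSeries_correct, CV_radius_inside, CV_radius_inv_binom_coef, Hz.
Qed.

Lemma series_inv_binom_term (m : R) :
  Rabs (/ (m ^ 2 + m ^ 3)) < 27 / 4 ->
  is_series (fun k => inv_binom_term m (S k))
    (/ (m ^ 2 + m ^ 3) * PSeries inv_binom_coef (/ (m ^ 2 + m ^ 3))).
Proof.
  set (z := / _). intros Hz.
  apply is_series_ext with (fun n => scal z (inv_binom_coef n * z ^ n)).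
  - intros n. unfold inv_binom_term, inv_binom_coef, scal, z.
    simpl (scal _ _). unfold mult. cbn -[INR Binomial.C pow Nat.mul].
    unfold Rdiv. rewrite !Rinv_mult, pow_inv. change (?a ^ S n) with (a * a ^ n).
    rewrite Rinv_mult. ring.
  - apply (is_series_scal z (fun n => inv_binom_coef n * z ^ n)), is_pseries_R.
    apply PSeries_correct, CV_radius_inside, CV_radius_inv_binom_coef, Hz.
Qed.

(** * Beta integrals and term-by-term integration *)

(** Induction on [b] with [a] general: integration by parts trades the exponents [(a, b + 1)] for
    [(a + 1, b)] at the cost of the factor [k], with zero boundary terms. *)
Lemma is_RInt_beta (a b : nat) :
  is_RInt (fun x => x ^ a * (1 - x) ^ b) 0 1
    (INR (fact a) * INR (fact b) / INR (fact (S (a + b)))).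
Proof.
  revert a; induction b as [| b IH]; intros a.
  - replace (INR (fact a) * INR (fact 0) / INR (fact (S (a + 0))))
      with (minus (/ INR (S a) * 1 ^ S a) (/ INR (S a) * 0 ^ S a)).
    + apply (is_RInt_derive (fun x => / INR (S a) * x ^ S a)).
      * intros x _. auto_derive; [easy |].
        change (match a with 0%nat => 1 | S _ => INR a + 1 end) with (INR (S a)).
        rewrite S_INR, pow_O. assert (H := pos_INR a). field. lra.
      * intros x _. apply (ex_derive_continuous (fun x => x ^ a * (1 - x) ^ 0)).
        auto_derive. easy.
    + rewrite pow1, pow_i, Nat.add_0_r, INR_fact_S, S_INR by lia.
      unfold minus, plus, opp. simpl (fact 0). simpl.
      assert (Hn := pos_INR a). field.
      split; [apply INR_fact_neq_0 | lra].
  - assert (Ha := pos_INR a). assert (Hb := pos_INR b).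
    set (k := (INR b + 1) / (INR a + 1)).
    set (f := fun x => x ^ S a * (1 - x) ^ S b / (INR a + 1)).
    assert (H : is_RInt (fun x => x ^ a * (1 - x) ^ S b
              - k * (x ^ S a * (1 - x) ^ b)) 0 1 (minus (f 1) (f 0))).
    { apply (is_RInt_derive f).
      - intros x _. unfold f, k. auto_derive; [easy |].
        change (match a with 0%nat => 1 | S _ => INR a + 1 end) with (INR (S a)).
        change (match b with 0%nat => 1 | S _ => INR b + 1 end) with (INR (S b)).
        rewrite !S_INR. change (1 + - x) with (1 - x). simpl pow. field. lra.
      - intros x _. apply (ex_derive_continuous
          (fun x => x ^ a * (1 - x) ^ S b - k * (x ^ S a * (1 - x) ^ b))).
        auto_derive. easy. }
    assert (H' := is_RInt_plus _ _ _ _ _ _ H (is_RInt_scal _ _ _ k _ (IH (S a)))).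
    replace (INR (fact a) * INR (fact (S b)) / INR (fact (S (a + S b)))) with
      (plus (minus (f 1) (f 0))
        (scal k (INR (fact (S a)) * INR (fact b) / INR (fact (S (S a + b)))))).
    + apply is_RInt_ext with (2 := H'). intros x _.
      unfold plus, scal. simpl. unfold mult. simpl. ring.
    + change (f 1 - f 0 + k * (INR (fact (S a)) * INR (fact b) /
        INR (fact (S (S a + b)))) =
        INR (fact a) * INR (fact (S b)) / INR (fact (S (a + S b)))).
      replace (f 1) with 0 by (unfold f; simpl; field; lra).
      replace (f 0) with 0 by (unfold f; simpl; field; lra).
      replace (a + S b)%nat with (S a + b)%nat by lia.
      rewrite (INR_fact_S a), (INR_fact_S b). unfold k.
      field. split; [apply INR_fact_neq_0 | lra].
Qed.

(** The factor [n + 1] is the one produced by differentiating [z ^ (n + 1)]. *)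
Lemma is_RInt_inv_binom_coef (n : nat) :
  is_RInt (fun x => x ^ (2 * n + 2) * (1 - x) ^ n) 0 1
    ((INR n + 1) * inv_binom_coef n).
Proof.
  replace ((INR n + 1) * inv_binom_coef n) with
    (INR (fact (2 * n + 2)) * INR (fact n) / INR (fact (S (2 * n + 2 + n)))).
  { apply is_RInt_beta. }
  unfold inv_binom_coef. rewrite C_3n_n.
  replace (2 * S n)%nat with (2 * n + 2)%nat by lia.
  replace (3 * S n)%nat with (S (2 * n + 2 + n)) by lia.
  rewrite (INR_fact_S n), S_INR. assert (Hn := pos_INR n).
  field. repeat split; try apply INR_fact_neq_0. lra.
Qed.

(** A uniform error [e n] of the partial sums contributes at most [(b - a) * e n] to the
    integral. *)
Lemma is_series_RInt (u : nat -> R -> R) (f : R -> R) (I e : nat -> R) (J a b : R) :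
  a <= b ->
  (forall n, is_RInt (u n) a b (I n)) ->
  is_RInt f a b J ->
  (forall n x, a <= x <= b -> Rabs (f x - sum_n (fun k => u k x) n) <= e n) ->
  is_lim_seq e 0 ->
  is_series I J.
Proof.
  intros Hab Hu Hf He Hlim.
  assert (HS : forall n,
    is_RInt (fun x => sum_n (fun k => u k x) n) a b (sum_n I n)).
  { intros n; induction n as [| n IH].
    - rewrite sum_O. apply is_RInt_ext with (2 := Hu 0%nat).
      intros x _. now rewrite sum_O.
    - rewrite sum_Sn.
      apply is_RInt_ext with (2 := is_RInt_plus _ _ _ _ _ _ IH (Hu (S n))).
      intros x _. now rewrite sum_Sn. }
  change (is_lim_seq (sum_n I) J).
  apply is_lim_seq_spec. intros eps.
  (* The extra 1 covers the case [a = b]. *)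
  assert (Hpos : 0 < eps / (b - a + 1)).
  { apply Rdiv_lt_0_compat; [apply cond_pos | lra]. }
  apply is_lim_seq_spec in Hlim.
  destruct (Hlim (mkposreal _ Hpos)) as [N HN]. exists N. intros n Hn.
  specialize (HN n Hn). simpl in HN. rewrite Rminus_0_r in HN.
  assert (H := norm_RInt_le_const
    (fun x => minus (f x) (sum_n (fun k => u k x) n)) a b _ (e n) Hab (He n)
    (is_RInt_minus _ _ _ _ _ _ Hf (HS n))).
  change (Rabs (J - sum_n I n) <= (b - a) * e n) in H.
  rewrite Rabs_minus_sym. apply Rle_lt_trans with (1 := H).
  apply Rle_lt_trans with ((b - a) * (eps / (b - a + 1))).
  - apply Rmult_le_compat_l; [lra |].
    apply Rle_trans with (1 := Rle_abs _). lra.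
  - apply Rlt_le_trans with ((b - a + 1) * (eps / (b - a + 1))); [nra |].
    right. field. lra.
Qed.

Lemma geometric_remainder (r : R) (n : nat) :
  r <> 1 -> / (1 - r) - sum_n (fun k => r ^ k) n = r ^ S n / (1 - r).
Proof.
  intros Hr. induction n as [| n IH].
  - rewrite sum_O. simpl. field. lra.
  - rewrite sum_Sn. unfold plus. simpl (plus _ _).
    replace (/ (1 - r) - _) with
      (/ (1 - r) - sum_n (fun k => r ^ k) n - r ^ S n) by (cbn; ring).
    rewrite IH. simpl. field. lra.
Qed.

(** On [[0, 1]] the geometric ratio [z x^2 (1 - x)] is at most [z / 4 < 1], which makes the
    convergence uniform. *)
Lemma PSeries_derive_inv_binom (z : R) :
  0 <= z -> z < 4 ->
  PSeries (PS_derive (PS_incr_1 inv_binom_coef)) z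
  = RInt (fun x => x ^ 2 / (1 - z * (x ^ 2 * (1 - x)))) 0 1.
Proof.
  intros Hz0 Hz4.
  assert (Hg : forall x, 0 <= x <= 1 -> 0 <= z * (x ^ 2 * (1 - x)) <= z / 4).
  { intros x Hx.
    assert (0 <= x ^ 2 * (1 - x)) by (apply Rmult_le_pos; nra).
    assert (0 <= x * (1 - x)) by nra.
    assert (x ^ 2 * (1 - x) <= x * (1 - x)) by nra.
    assert (x * (1 - x) <= 1 / 4) by (assert (Hsq := pow2_ge_0 (x - 1 / 2)); lra).
    split; [now apply Rmult_le_pos | nra]. }
  set (f := fun x => _).
  assert (Hf : is_RInt f 0 1 (RInt f 0 1)).
  { apply (RInt_correct f), (ex_RInt_continuous (V := R_CompleteNormedModule)).
    intros x. rewrite Rmin_left, Rmax_right by lra. intros Hx.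
    apply (ex_derive_continuous f). unfold f. auto_derive.
    specialize (Hg x Hx). simpl in Hg. lra. }
  apply is_pseries_unique, is_pseries_R.
  apply (is_series_RInt
    (fun n x => z ^ n * (x ^ (2 * n + 2) * (1 - x) ^ n)) f _
    (* The error bound is the geometric remainder at the largest ratio [z / 4]; the factor
       [x ^ 2 <= 1] is dropped. *)
    (fun n => (z / 4) * (z / 4) ^ n / (1 - z / 4)) _ 0 1); try easy; try lra.
  - intros n.
    replace (PS_derive (PS_incr_1 inv_binom_coef) n * z ^ n)
      with (z ^ n * ((INR n + 1) * inv_binom_coef n)).
    + exact (is_RInt_scal _ 0 1 (z ^ n) _ (is_RInt_inv_binom_coef n)).
    + unfold PS_derive, PS_incr_1. rewrite S_INR. ring.
  - intros n x Hx. specialize (Hg x Hx). set (r := z * _) in Hg.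
    replace (sum_n _ n) with (x ^ 2 * sum_n (fun k => r ^ k) n).
    + replace (f x) with (x ^ 2 * / (1 - r)) by reflexivity.
      rewrite <- Rmult_minus_distr_l, geometric_remainder by lra.
      assert (0 <= r ^ S n) by (apply pow_le; lra).
      assert (r ^ S n <= (z / 4) ^ S n) by (apply pow_incr; lra).
      assert (0 < / (1 - r)) by (apply Rinv_0_lt_compat; lra).
      assert (/ (1 - r) <= / (1 - z / 4)) by (apply Rinv_le_contravar; lra).
      assert (0 <= x ^ 2 <= 1) by nra.
      change (z / 4 * (z / 4) ^ n) with ((z / 4) ^ S n).
      assert (0 <= r ^ S n / (1 - r) <= (z / 4) ^ S n / (1 - z / 4)).
      { split; [apply Rmult_le_pos; lra | apply Rmult_le_compat; lra]. }
      rewrite Rabs_pos_eq by nra. nra.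
    + rewrite <- (sum_n_mult_l (K := R_Ring)). apply sum_n_ext. intros k.
      change (x ^ 2 * r ^ k = z ^ k * (x ^ (2 * k + 2) * (1 - x) ^ k)).
      unfold r. rewrite !Rpow_mult_distr, pow_add, pow_mult. ring.
  - replace (Finite 0) with (Rbar_mult (z / 4 / (1 - z / 4)) 0)
      by (simpl; f_equal; ring).
    apply is_lim_seq_ext with (fun n => z / 4 / (1 - z / 4) * (z / 4) ^ n).
    { intros n. field. lra. }
    apply is_lim_seq_scal_l, is_lim_seq_geom. rewrite Rabs_pos_eq; lra.
Qed.

(** * The closed form *)

Lemma cubic_pos (m : R) : 0 < m -> 0 < m ^ 2 + m ^ 3.
Proof. intros Hm. apply Rplus_lt_0_compat; now apply pow_lt. Qed.

Lemma RInt_cubic_kernel (m : R) :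
  1 / 2 < m ->
  RInt (fun x => x ^ 2 / (1 - / (m ^ 2 + m ^ 3) * (x ^ 2 * (1 - x)))) 0 1
  = (m ^ 2 + m ^ 3) / (3 * m + 2) *
    (2 * (m + 1) / sqrt ((m + 1) * (3 * m - 1)) *
       atan (sqrt ((m + 1) * (3 * m - 1)) / ((m + 1) * (2 * m - 1)))
     - ln (1 + 1 / m)).
Proof.
  intros hm. set (s := sqrt _).
  assert (Hs2 : s ^ 2 = (m + 1) * (3 * m - 1)) by (apply pow2_sqrt; nra).
  assert (Hs : 0 < s) by (apply sqrt_lt_R0; nra).
  (* The quadratic factor of the denominator; its discriminant is [- s ^ 2 < 0], so it is positive
     everywhere. *)
  set (Q := fun x => x ^ 2 - (m + 1) * x + m * (m + 1)).
  assert (HQ : forall x, 0 < Q x).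
  { intros x. unfold Q. assert (H := pow2_ge_0 (x - (m + 1) / 2)). nra. }
  (* Unlike the arctangent of [(2 x - (m + 1)) / s], this antiderivative of
     [s / (2 Q)] vanishes at 0, so no arctangent addition formula is needed. *)
  set (A := fun x => atan (s * x / ((m + 1) * (2 * m - x)))).
  (* The bound [m > 1 / 2] keeps the pole [x = 2 m] of the argument outside [[0, 1]]. *)
  assert (HA : forall x, 0 <= x <= 1 -> is_derive A x (s / (2 * Q x))).
  { intros x Hx. unfold A. auto_derive.
    - apply Rgt_not_eq, Rmult_lt_0_compat; lra.
    - assert (E : 1 + (s * x * / ((m + 1) * (2 * m + - x))) ^ 2
        = 4 * m * Q x / ((m + 1) * (2 * m - x) ^ 2)).
      { unfold Q. rewrite !Rpow_mult_distr, Hs2. field. lra. }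
      simpl in E. rewrite E. specialize (HQ x). field. repeat split; lra. }
  set (K := (m ^ 2 + m ^ 3) / (3 * m + 2)).
  (* Partial fractions: [(3 m + 2) x^2 / ((x + m) Q) = m / (x + m) + (m + 1) (2 x - m) / Q], where
     [2 x - m = Q' + 1] splits into a logarithmic and an arctangent part. *)
  set (P := fun x => K * (m * ln (x + m) + (m + 1) * ln (Q x)
                       + 2 * (m + 1) / s * A x)).
  transitivity (minus (P 1) (P 0)).
  - assert (Hm := cubic_pos m ltac:(lra)).
    assert (Hden : forall x, 1 - / (m ^ 2 + m ^ 3) * (x ^ 2 * (1 - x))
        = (x + m) * Q x / (m ^ 2 + m ^ 3)).
    { intros x. unfold Q. field. lra. }
    apply is_RInt_unique, (is_RInt_derive P).
    + intros x. rewrite Rmin_left, Rmax_right by lra. intros Hx.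
      specialize (HA x Hx). specialize (HQ x).
      rewrite Hden. unfold P. auto_derive.
      * repeat split; try lra; [| now exists (s / (2 * Q x))].
        unfold Q. auto_derive. easy.
      * replace (Derive (fun x => A x) x) with (s / (2 * Q x))
          by (symmetry; now apply is_derive_unique).
        replace (Derive (fun x => Q x) x) with (2 * x - (m + 1))
          by (symmetry; apply is_derive_unique; unfold Q; auto_derive; [easy | ring]).
        unfold K. field_simplify_eq; [unfold Q; ring |].
        repeat split; lra.
    + intros x. rewrite Rmin_left, Rmax_right by lra. intros Hx.
      apply (ex_derive_continuous
        (fun x => x ^ 2 / (1 - / (m ^ 2 + m ^ 3) * (x ^ 2 * (1 - x))))).
      auto_derive. change (1 - / (m ^ 2 + m ^ 3) * (x ^ 2 * (1 - x)) <> 0).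
      rewrite Hden. apply Rgt_not_eq, Rdiv_lt_0_compat; [| easy].
      apply Rmult_lt_0_compat; [lra | easy].
  - change (P 1 - P 0 = K *
      (2 * (m + 1) / s * atan (s / ((m + 1) * (2 * m - 1))) - ln (1 + 1 / m))).
    unfold P, A.
    replace (Q 1) with (m * m) by (unfold Q; ring).
    replace (Q 0) with (m * (m + 1)) by (unfold Q; ring).
    replace (s * 0 / _) with 0 by (field; lra).
    replace (1 + 1 / m) with ((m + 1) / m) by (field; lra).
    rewrite ln_div, !ln_mult, atan_0, Rplus_0_l, Rmult_1_r, (Rplus_comm 1 m) by lra.
    ring.
Qed.

(** * Derivatives of the two sides *)

Lemma is_derive_PSeries_incr_inv_binom (z : R) :
  0 <= z -> z < 4 ->
  is_derive (fun z => z * PSeries inv_binom_coef z) z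
    (RInt (fun x => x ^ 2 / (1 - z * (x ^ 2 * (1 - x)))) 0 1).
Proof.
  intros Hz0 Hz4. rewrite <- PSeries_derive_inv_binom by easy.
  apply is_derive_ext with (PSeries (PS_incr_1 inv_binom_coef)).
  - intros t. apply PSeries_incr_1.
  - apply is_derive_PSeries. rewrite CV_radius_incr_1.
    apply CV_radius_inv_binom_coef. rewrite Rabs_pos_eq; lra.
Qed.

Lemma sqrt_arg_eq (m : R) :
  1 / 2 < m ->
  sqrt ((3 * m - 1) / ((m + 1) * (2 * m - 1) ^ 2))
  = sqrt ((m + 1) * (3 * m - 1)) / ((m + 1) * (2 * m - 1)).
Proof.
  intros hm.
  replace ((3 * m - 1) / ((m + 1) * (2 * m - 1) ^ 2)) with
    ((m + 1) * (3 * m - 1) / ((m + 1) * (2 * m - 1)) ^ 2) by (field; lra).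
  rewrite sqrt_div_alt, sqrt_pow2; [easy | nra |].
  apply pow_lt. nra.
Qed.

(** The arctangent has the argument produced by [RInt_cubic_kernel]; [sqrt_arg_eq] relates it to the
    single square root of the theorem. *)
Definition closed_form (m : R) : R :=
  2 / 3 * (atan (sqrt ((m + 1) * (3 * m - 1)) / ((m + 1) * (2 * m - 1)))) ^ 2
    - 1 / 2 * (ln (1 + 1 / m)) ^ 2.

Definition common_derivative (m : R) : R :=
  - (2 / (m * sqrt ((m + 1) * (3 * m - 1))) *
     atan (sqrt ((m + 1) * (3 * m - 1)) / ((m + 1) * (2 * m - 1))))
  + ln (1 + 1 / m) / (m * (m + 1)).

Lemma is_derive_closed_form (m : R) :
  1 / 2 < m ->
  is_derive closed_form m (common_derivative m).
Proof.
  intros hm.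
  assert (Hs2 : sqrt ((m + 1) * (3 * m - 1)) ^ 2 = (m + 1) * (3 * m - 1))
    by (apply pow2_sqrt; nra).
  assert (Hs : 0 < sqrt ((m + 1) * (3 * m - 1))) by (apply sqrt_lt_R0; nra).
  assert (HA : is_derive
    (fun m => atan (sqrt ((m + 1) * (3 * m - 1)) / ((m + 1) * (2 * m - 1)))) m
    (- 3 / (2 * m * sqrt ((m + 1) * (3 * m - 1))))).
  { auto_derive.
    - change (3 * m + - (1)) with (3 * m - 1). change (2 * m + - (1)) with (2 * m - 1).
      repeat split; nra.
    - change (3 * m + - (1)) with (3 * m - 1). change (2 * m + - (1)) with (2 * m - 1).
      set (s := sqrt _) in *.
      (* The numerator [(3 m - 1) + (m + 1) (2 m - 1)^2] collapses to [4 m^3]. *)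
      assert (E : 1 + (s * / ((m + 1) * (2 * m - 1))) ^ 2
         = 4 * m ^ 3 / ((m + 1) * (2 * m - 1) ^ 2)).
      { rewrite !Rpow_mult_distr, Hs2. field. lra. }
      simpl in E. rewrite E. field_simplify_eq; [| repeat split; nra].
      rewrite Hs2. ring. }
  set (A := fun m => atan _) in HA.
  change (is_derive (fun m => 2 / 3 * A m ^ 2 - 1 / 2 * ln (1 + 1 / m) ^ 2) m
    (- (2 / (m * sqrt ((m + 1) * (3 * m - 1))) * A m)
     + ln (1 + 1 / m) / (m * (m + 1)))).
  auto_derive.
  - assert (0 < / m) by (apply Rinv_0_lt_compat; lra).
    repeat split; try lra. eexists; exact HA.
  - replace (Derive (fun x => A x) m)
      with (- 3 / (2 * m * sqrt ((m + 1) * (3 * m - 1))))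
      by (symmetry; now apply is_derive_unique).
    unfold Rdiv. rewrite Rmult_1_l. field. repeat split; lra.
Qed.

(** For [m > 1 / 2] already [m ^ 2 > 1 / 4]; the bound 4 is what the uniform geometric estimate
    requires. *)
Lemma inv_cubic_bounds (m : R) : 1 / 2 < m -> 0 < / (m ^ 2 + m ^ 3) < 4.
Proof.
  intros hm. assert (H := cubic_pos m ltac:(lra)). split.
  - now apply Rinv_0_lt_compat.
  - rewrite <- (Rinv_inv 4). apply Rinv_lt_contravar; nra.
Qed.

Definition series_form (m : R) : R :=
  / (m ^ 2 + m ^ 3) * PSeries inv_binom_coef (/ (m ^ 2 + m ^ 3)).

(** Chain rule: the inner derivative contains [m (3 m + 2)], which cancels the denominator [3 m + 2]
    of the kernel integral. *)
Lemma is_derive_series_form (m : R) :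
  1 / 2 < m ->
  is_derive series_form m (common_derivative m).
Proof.
  intros hm.
  assert (Hz := inv_cubic_bounds m hm).
  assert (Hc := cubic_pos m ltac:(lra)).
  assert (Hs : 0 < sqrt ((m + 1) * (3 * m - 1))) by (apply sqrt_lt_R0; nra).
  assert (HD := is_derive_PSeries_incr_inv_binom (/ (m ^ 2 + m ^ 3))
    ltac:(lra) ltac:(lra)).
  rewrite RInt_cubic_kernel in HD by easy.
  assert (Hd : is_derive (fun m => / (m ^ 2 + m ^ 3)) m
     (- (2 * m + 3 * m ^ 2) / (m ^ 2 + m ^ 3) ^ 2)).
  { auto_derive; [simpl in Hc; lra |]. field. simpl in Hc; lra. }
  assert (H := is_derive_comp _ _ _ _ _ HD Hd).
  match type of H with
    is_derive _ _ ?l => replace (common_derivative m) with l; [exact H |]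
  end.
  unfold common_derivative, scal. simpl (mult _ _). unfold mult. cbn -[pow].
  field. repeat split; nra.
Qed.

(** * Limits at infinity *)

Lemma is_lim_p_infty_inv : is_lim (fun m => / m) p_infty 0.
Proof.
  apply (is_lim_inv (fun m => m) p_infty p_infty); [apply is_lim_id | easy].
Qed.

Lemma is_lim_0_of_le_inv (f : R -> R) (K : R) :
  (forall m, 1 <= m -> 0 <= f m <= / m * K) -> is_lim f p_infty 0.
Proof.
  intros Hf.
  apply (is_lim_le_le_loc (fun _ => 0) (fun m => / m * K) f p_infty 0).
  - exists 1. intros m Hm. apply Hf. lra.
  - apply is_lim_const.
  - replace (Finite 0) with (Rbar_mult 0 K) by (simpl; f_equal; ring).
    apply is_lim_scal_r, is_lim_p_infty_inv.
Qed.

Lemma is_lim_series_form : is_lim series_form p_infty 0.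
Proof.
  replace 0 with (0 * PSeries inv_binom_coef 0) by ring.
  apply (is_lim_comp_continuous (fun m => / (m ^ 2 + m ^ 3))
    (fun z => z * PSeries inv_binom_coef z) p_infty 0).
  - apply is_lim_0_of_le_inv with 1. intros m Hm.
    assert (Hc := cubic_pos m ltac:(lra)). split.
    + left. now apply Rinv_0_lt_compat.
    + rewrite Rmult_1_r. apply Rinv_le_contravar; nra.
  - apply (ex_derive_continuous (fun z => z * PSeries inv_binom_coef z)).
    eexists. apply is_derive_PSeries_incr_inv_binom; lra.
Qed.

Lemma is_lim_closed_form : is_lim closed_form p_infty 0.
Proof.
  apply is_lim_ext_loc with (fun m =>
    2 / 3 * (atan (sqrt ((3 * m - 1) / ((m + 1) * (2 * m - 1) ^ 2)))) ^ 2
    - 1 / 2 * (ln (1 + / m)) ^ 2).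
  { exists 1. intros m Hm. unfold closed_form. rewrite sqrt_arg_eq by lra.
    now replace (1 / m) with (/ m) by (field; lra). }
  replace (Finite 0) with (Finite (0 - 0)) by (f_equal; ring).
  apply is_lim_minus'.
  - replace 0 with (2 / 3 * atan (sqrt 0) ^ 2)
      by (rewrite sqrt_0, atan_0; ring).
    apply (is_lim_comp_continuous (fun m => (3 * m - 1) / ((m + 1) * (2 * m - 1) ^ 2))
      (fun w => 2 / 3 * atan (sqrt w) ^ 2) p_infty 0).
    (* For [m >= 1] one has [2 m - 1 >= m], so the quotient is at most [3 / m]. *)
    + apply is_lim_0_of_le_inv with 3. intros m Hm.
      assert (0 < (m + 1) * (2 * m - 1) ^ 2) by (apply Rmult_lt_0_compat; nra).
      split.
      * apply Rmult_le_pos; [lra |]. left. now apply Rinv_0_lt_compat.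
      * apply Rle_div_l; [easy |]. apply Rmult_le_reg_l with m; [lra |].
        replace (m * (/ m * 3 * ((m + 1) * (2 * m - 1) ^ 2)))
          with (3 * ((m + 1) * (2 * m - 1) ^ 2)) by (field; lra).
        assert (m ^ 2 <= (2 * m - 1) ^ 2) by (apply pow_incr; lra). nra.
    + apply (continuous_comp sqrt (fun v => 2 / 3 * atan v ^ 2)).
      (* Two-sided continuity at 0 holds because [sqrt] is 0 on negative numbers. *)
      * apply continuous_sqrt.
      * apply (ex_derive_continuous (fun v => 2 / 3 * atan v ^ 2)).
        auto_derive. easy.
  - replace 0 with (1 / 2 * ln (1 + 0) ^ 2) by (rewrite Rplus_0_r, ln_1; ring).
    apply (is_lim_comp_continuous Rinv (fun y => 1 / 2 * ln (1 + y) ^ 2) p_infty 0).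
    + apply is_lim_p_infty_inv.
    + apply (ex_derive_continuous (fun y => 1 / 2 * ln (1 + y) ^ 2)).
      auto_derive. lra.
Qed.

(** The difference [h] has zero derivative beyond 1/2, so it is constant from [m] on; its limit 0 at
    infinity is therefore its value at [m]. *)
Lemma series_form_eq_closed_form (m : R) :
  1 / 2 < m -> series_form m = closed_form m.
Proof.
  intros hm. set (h := fun t => series_form t - closed_form t).
  assert (Hconst : forall t, m < t -> h m = h t).
  { intros t Ht. apply eq_is_derive; [| easy]. intros y Hy.
    assert (H := is_derive_minus _ _ _ _ _
      (is_derive_series_form y ltac:(lra)) (is_derive_closed_form y ltac:(lra))).
    rewrite minus_eq_zero in H. exact H. }
  assert (H0 : is_lim h p_infty (0 - 0))
    by (apply is_lim_minus'; [apply is_lim_series_form | apply is_lim_closed_form]).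
  assert (Hm : is_lim h p_infty (h m)).
  { apply is_lim_ext_loc with (fun _ => h m); [now exists m | apply is_lim_const]. }
  apply is_lim_unique in H0. apply is_lim_unique in Hm.
  rewrite H0 in Hm. injection Hm. unfold h. lra.
Qed.

(** Convergence is asserted separately because [PSeries] and [Series] are total and take some value
    even on divergent series. *)
Theorem theorem4 (m : R) (hm : 1 / 2 < m) :
  ex_pseries (hyp4F3_coef 1 1 1 (3 / 2) (4 / 3) (5 / 3) 2)
    (4 / (27 * (m ^ 2 + m ^ 3))) /\
  ex_series (fun k : nat => inv_binom_term m (S k)) /\
  1 / (3 * m ^ 2 + 3 * m ^ 3) *
    hyp4F3 1 1 1 (3 / 2) (4 / 3) (5 / 3) 2 (4 / (27 * (m ^ 2 + m ^ 3)))
  = Series (fun k : nat => inv_binom_term m (S k)) /\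
  Series (fun k : nat => inv_binom_term m (S k))
  = 2 / 3 * (atan (sqrt ((3 * m - 1) / ((m + 1) * (2 * m - 1) ^ 2)))) ^ 2
    - 1 / 2 * (ln (1 + 1 / m)) ^ 2.
Proof.
  assert (Hz := inv_cubic_bounds m hm).
  assert (Hc := cubic_pos m ltac:(lra)).
  assert (Hz' : Rabs (/ (m ^ 2 + m ^ 3)) < 27 / 4) by (rewrite Rabs_pos_eq; lra).
  assert (Hh := pseries_hyp4F3_coef _ Hz').
  assert (Ht := series_inv_binom_term m Hz').
  (* The hypergeometric argument is [4 z / 27] with [z = 1 / (m^2 + m^3)]. *)
  replace (4 / 27 * / (m ^ 2 + m ^ 3)) with (4 / (27 * (m ^ 2 + m ^ 3))) in Hh
    by (field; lra).
  repeat split.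
  - eexists; exact Hh.
  - eexists; exact Ht.
  - unfold hyp4F3. rewrite (is_pseries_unique _ _ _ Hh), (is_series_unique _ _ Ht).
    field. lra.
  - rewrite (is_series_unique _ _ Ht), sqrt_arg_eq by easy.
    now apply series_form_eq_closed_form.
Qed.
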